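(* Let $L>0$, $\mu\in(-\infty,0)$, $\kappa:=\mu/L$, let $N$ be a positive integer and let $\gamma L\in(1,\overline{\gamma L}_1(\kappa)]$, where $\overline{\gamma L}_1(\kappa):=\frac{3}{1+\kappa+\sqrt{1-\kappa+\kappa^2}}$. Then there exist $x_0$ and $f\in\mathcal{F}_{\mu,L}$ such that after applying $N$ iterations of gradient descent $x_{i+1}=x_i-\gamma\nabla f(x_i)$, $i=0,\dots,N-1$, on the function $f$ with constant stepsize $\gamma$ (normalized stepsize $\gamma L$), starting from $x_0$, it holds $$\frac1{2L}\min_{0\le i\le N}\{\|\nabla f(x_i)\|^2\}=\frac{f(x_0)-f_*}{1+\gamma L\,\frac{(2-\gamma L)(2-\gamma\mu)}{2-\gamma L-\gamma\mu}\,N}.$$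
   Context: For $L\in(0,\infty)$ and $\mu\in(-\infty,L)$, $\mathcal{F}_{\mu,L}$ is the class of functions $f:\mathbb{R}^d\to\mathbb{R}$ such that both $\frac{L}{2}\|\cdot\|^2-f$ and $f-\frac{\mu}{2}\|\cdot\|^2$ are convex ($\|\cdot\|$ is the Euclidean norm; such functions are differentiable). Functions $f$ are assumed bounded below, and $f_*:=\inf_x f(x)>-\infty$. *)

(* Defs.v *)
From mathcomp Require Import all_boot all_order all_algebra.
From mathcomp Require Import all_classical all_reals all_analysis.

Set Implicit Arguments.
Unset Strict Implicit.
Unset Printing Implicit Defensive.

Import Order.TTheory GRing.Theory Num.Theory.
Import numFieldNormedType.Exports.

Local Open Scope classical_set_scope.
Local Open Scope ring_scope.

(* The canonical norm `|x| on 'rV[R]_d is the sup norm, hence a separate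
   Euclidean norm. Both induce the same topology and thus the same derivatives. *)
Definition enorm (R : realType) (d : nat) (x : 'rV[R]_d) : R :=
  Num.sqrt (\sum_(i < d) x 0 i ^+ 2).

(* The class F_(mu,L), meant for 0 < L and mu < L (mu may be negative); f is
   then differentiable, so grad f below is the true gradient. *)
Definition curvature_class (R : realType) (d : nat) (mu L : R)
    (f : 'rV[R]_d -> R) : Prop :=
  convex_function setT (fun x : 'rV[R]_d => L / 2 * enorm x ^+ 2 - f x) /\
  convex_function setT (fun x : 'rV[R]_d => f x - mu / 2 * enorm x ^+ 2).

Definition grad (R : realType) (d : nat) (f : 'rV[R]_d -> R) (x : 'rV[R]_d) :
    'rV[R]_d :=
  \row_(i < d) 'D_(delta_mx 0 i) f x.

Definition gd (R : realType) (d : nat) (gamma : R) (f : 'rV[R]_d -> R)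
    (x0 : 'rV[R]_d) (i : nat) : 'rV[R]_d :=
  iter i (fun x => x - gamma *: grad f x) x0.

Definition gammaL1 (R : realType) (kappa : R) : R :=
  3 / (1 + kappa + Num.sqrt (1 - kappa + kappa ^+ 2)).

(* The minimum over 0 <= i <= N; the default value is the term i = 0, so it
   does not affect the result. *)
Definition min_sq_grad (R : realType) (d : nat) (gamma : R)
    (f : 'rV[R]_d -> R) (x0 : 'rV[R]_d) (N : nat) : R :=
  \big[Num.min/enorm (grad f (gd gamma f x0 0)) ^+ 2]_(i < N.+1)
    enorm (grad f (gd gamma f x0 i)) ^+ 2.

(* Main.v *)
Require Import Defs.
From mathcomp Require Import all_boot all_order all_algebra.
From mathcomp Require Import all_classical all_reals all_analysis.
From mathcomp Require Import ring lra.

(** Two facts carry the proof: functions with curvature in [mu, L] can be built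
    as envelopes, and there is a zigzag that gradient descent follows
    on a suitable envelope.

    Envelopes.  Let mu < L, let M be a nonempty set of functions m such
    that m - mu/2 |.|^2 is convex, and let f(x) be the infimum of q(x) over all
    quadratics q(x) = v + L/2 |x - y|^2 that majorize every member of M, provided
    that there is one.  Then
    f lies above M and below each majorant, and f belongs to the class F_(mu,L)
    ([envelope_curvature]): L/2 |.|^2 - f is a supremum of affine functions, and
    f - mu/2 |.|^2 is convex because two majorants can be mixed into a third
    one that is good enough at any convex combination of points
    ([majorants_mix]).  So, in order to prescribe values f_i and gradients g_i
    at points x_i, it suffices that each lower tangent
    f_j + <g_j, x - x_j> + mu/2 |x - x_j|^2 be below each upper tangent
    f_i + <g_i, x - x_i> + L/2 |x - x_i|^2: put the lower tangents in M; the
    envelope is then squeezed at x_i between two quadratics with gradient g_i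
    ([grad_sandwich]).  A constant in M prescribes a lower bound for f.

    The zigzag.  In a plane take gradients g_i = (a, b), (a, -b), (a, b), ...,
    the points x_(i+1) = x_i - gamma g_i with x_0 = 0, and the values
    f_i = - i gamma a^2.  Apart from the linear function with slope a along the
    first axis, the data are periodic.  Tangents at indices of the same parity
    are then trivially ordered, and for indices at odd distance n the gap of
    the tangents has a minimum of the sign of (n^2 - 1) provided that
      a^2 = (2 - gamma mu) (2 - gamma L)   and   b^2 = - L mu gamma^2
    ([gap_ge0]); it vanishes at n = 1, which makes the example extremal.  All
    gradients have |g_i|^2 = 2 D with D = 2 - gamma L - gamma mu.  The minimum
    of the upper tangent at x_i is f_i - D/L, which decreases in i, so the
    constant f_N - D/L may be added to M; it is the value of the last upper
    tangent at its minimizer, hence the minimum of f.  The ratio of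
    f(x_0) - f_* = D/L + N gamma a^2 to D/L = min_i |g_i|^2 / (2L) is the
    claimed factor.  The threshold on the stepsize enters only through
    gamma L < 2 ([gammaL1_lt2]), which makes a^2 positive.  On the line the zigzag
    has no room and the constant function gives the equality 0 = 0. *)

Import Order.TTheory GRing.Theory Num.Theory.
Import numFieldNormedType.Exports.

Local Open Scope classical_set_scope.
Local Open Scope ring_scope.

Set Implicit Arguments.
Unset Strict Implicit.
Unset Printing Implicit Defensive.

(** * The Euclidean inner product, convexity and gradients *)

Section Dot.
Context {R : realType} {d : nat}.
Implicit Types (u v w x y : 'rV[R]_d) (c : R).

Definition dot u v : R := \sum_(i < d) u 0 i * v 0 i.

Lemma dotC u v : dot u v = dot v u.
Proof. by apply: eq_bigr => i _; rewrite mulrC. Qed.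

Lemma dotDl u v w : dot (u + v) w = dot u w + dot v w.
Proof. by rewrite -big_split; apply: eq_bigr => i _ /=; rewrite mxE mulrDl. Qed.

Lemma dotZl c u w : dot (c *: u) w = c * dot u w.
Proof. by rewrite /dot mulr_sumr; apply: eq_bigr => i _; rewrite mxE mulrA. Qed.

Lemma dotNl u w : dot (- u) w = - dot u w.
Proof. by rewrite -scaleN1r dotZl mulN1r. Qed.

Lemma dotDr u v w : dot w (u + v) = dot w u + dot w v.
Proof. by rewrite dotC dotDl !(dotC w). Qed.

Lemma dotZr c u w : dot w (c *: u) = c * dot w u.
Proof. by rewrite dotC dotZl dotC. Qed.

Lemma dotNr u w : dot w (- u) = - dot w u.
Proof. by rewrite dotC dotNl dotC. Qed.

Lemma dot0l w : dot 0 w = 0.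
Proof. by rewrite -(scale0r 0) dotZl mul0r. Qed.

Lemma dot0r w : dot w 0 = 0.
Proof. by rewrite dotC dot0l. Qed.

Definition dotE := (dotDl, dotDr, dotNl, dotNr, dotZl, dotZr).

Lemma dot_delta u i : dot u (delta_mx 0 i) = u 0 i.
Proof.
rewrite /dot (bigD1 i) //= mxE !eqxx mulr1 big1 ?addr0 // => j ji.
by rewrite mxE (negbTE ji) andbF mulr0.
Qed.

Lemma dot_ge0 u : 0 <= dot u u.
Proof. by apply: sumr_ge0 => i _; rewrite -expr2 sqr_ge0. Qed.

Lemma enorm_sqr u : enorm u ^+ 2 = dot u u.
Proof.
by rewrite sqr_sqrtr; [|apply: sumr_ge0 => i _; exact: sqr_ge0].
Qed.

Lemma dot_ge_coord2 i0 i1 u : i0 != i1 ->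
  u 0 i0 ^+ 2 + u 0 i1 ^+ 2 <= dot u u.
Proof.
move=> i01; rewrite /dot (bigD1 i0) //= (bigD1 i1) /= ?[i1 == _]eq_sym //.
rewrite addrA !expr2 lerDl; apply: sumr_ge0 => i _.
by rewrite -expr2 sqr_ge0.
Qed.

Definition cvx (f : 'rV[R]_d -> R) := forall t x y, 0 <= t <= 1 ->
  f (t *: x + (1 - t) *: y) <= t * f x + (1 - t) * f y.

Lemma cvx_convex f : cvx f -> convex_function setT f.
Proof. by move=> H t x y _ _; apply: H; rewrite ge0 le1. Qed.

(** At p the difference quotients of f along a coordinate axis differ from the
    component of g by at most a multiple of the increment. *)
Lemma grad_sandwich c1 c2 (f : 'rV[R]_d -> R) p g :
  (forall x, f p + dot g (x - p) + c1 / 2 * dot (x - p) (x - p) <= f x) ->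
  (forall x, f x <= f p + dot g (x - p) + c2 / 2 * dot (x - p) (x - p)) ->
  grad f p = g.
Proof.
move=> lo hi; apply/rowP => i; rewrite mxE; apply: cvg_lim => //.
(* The summand 1 only serves to make C positive. *)
pose C : R := `|c1| + `|c2| + 1.
have C0 : 0 < C by rewrite ltr_wpDl// addr_ge0.
apply/cvgrPdist_le => e e0; near=> h.
have h0 : h != 0 by near: h; exact: nbhs_dnbhs_neq.
have hC : `|h| * C <= e.
  rewrite -ler_pdivlMr //; near: h; apply: dnbhs0_le.
  by rewrite divr_gt0.
rewrite /= /shift /=.
have := lo (h *: delta_mx 0 i + p); have := hi (h *: delta_mx 0 i + p).
rewrite addrK !dotE !dot_delta mxE !eqxx mulr1 => {}hi {}lo.
set q := f (h *: _ + _) in lo hi *.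
have bnd : `|h * (g 0 i) - (q - f p)| <= h * h * C.
  have hh : 0 <= h * h by rewrite -expr2 sqr_ge0.
  have n1 := ler_norm (- c1); have n2 := ler_norm c2.
  rewrite normrN in n1.
  have := normr_ge0 c1; have := normr_ge0 c2 => p2 p1.
  have k1 : h * h * - c1 <= h * h * C by rewrite ler_wpM2l// /C; lra.
  have k2 : h * h * c2 <= h * h * C by rewrite ler_wpM2l// /C; lra.
  have k3 : 0 <= h * h * C by rewrite mulr_ge0 // ltW.
  by rewrite ler_norml; apply/andP; split; lra.
have -> : g 0 i - h^-1 * (q - f p) = h^-1 * (h * g 0 i - (q - f p)) by field.
rewrite normrM normfV ler_pdivrMl ?normr_gt0 //.
apply: le_trans bnd _; rewrite -expr2 -real_normK ?num_real // expr2 -mulrA.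
by rewrite ler_wpM2l.
Unshelve. all: by end_near.
Qed.

End Dot.

(** * Envelopes of quadratic majorants *)

Section Envelope.
Context {R : realType} {d : nat}.
Implicit Types (x y : 'rV[R]_d) (c : R).

(** The quadratic of curvature L with minimizer yv.1 and minimum yv.2. *)
Definition bowl (L : R) (yv : 'rV[R]_d * R) x : R :=
  yv.2 + L / 2 * dot (x - yv.1) (x - yv.1).

Definition majorants (L : R) (M : set ('rV[R]_d -> R)) : set ('rV[R]_d * R) :=
  [set yv | forall m, M m -> forall x, m x <= bowl L yv x].

Definition envelope (L : R) (M : set ('rV[R]_d -> R)) x : R :=
  inf [set bowl L yv x | yv in majorants L M].

Variables (L mu : R) (M : set ('rV[R]_d -> R)).
Hypothesis muL : mu < L.
Hypothesis M0 : M !=set0.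
Hypothesis maj0 : majorants L M !=set0.
Hypothesis Mcvx : forall m, M m -> cvx (fun x => m x - mu / 2 * dot x x).

Let values x := [set bowl L yv x | yv in majorants L M].

Let values_lb x : has_lbound (values x).
Proof.
have [m Mm] := M0; exists (m x) => _ [yv h <-]; exact: h.
Qed.

Let values_n0 x : values x !=set0.
Proof. by have [yv h] := maj0; exists (bowl L yv x); exists yv. Qed.

Lemma envelope_le yv x : majorants L M yv -> envelope L M x <= bowl L yv x.
Proof. by move=> h; apply: (ge_inf (values_lb x)); exists yv. Qed.

Lemma envelope_ge m x : M m -> m x <= envelope L M x.
Proof.
by move=> Mm; apply: (lb_le_inf (values_n0 x)) => _ [yv h <-]; exact: h.
Qed.

(** Each bowl differs from L/2 |.|^2 by an affine function, so its values satisfy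
    the wanted inequality with equality; it passes to the infimum. *)
Lemma envelope_cvx_above : cvx (fun x => L / 2 * dot x x - envelope L M x).
Proof.
move=> t x y /andP[t0 t1].
have s0 : 0 <= 1 - t by rewrite subr_ge0.
suff : t * envelope L M x + (1 - t) * envelope L M y
    - L / 2 * (t * (1 - t)) * dot (x - y) (x - y)
    <= envelope L M (t *: x + (1 - t) *: y).
  by rewrite !dotE (dotC y x); lra.
apply: (lb_le_inf (values_n0 _)) => _ [yv h <-].
have hx := ler_wpM2l t0 (envelope_le x h).
have hy := ler_wpM2l s0 (envelope_le y h).
apply: le_trans (_ : _ <= t * bowl L yv x + (1 - t) * bowl L yv y
    - L / 2 * (t * (1 - t)) * dot (x - y) (x - y)) _; first by lra.
rewrite le_eqVlt; apply/orP; left; apply/eqP.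
rewrite /bowl; case: yv {h hx hy} => z v /=.
rewrite !dotE (dotC z x) (dotC z y) (dotC y x); ring.
Qed.

(** The left-hand side of the identity minus the first two terms on the right is
    a quadratic form in (x1 - x2, y1 - y2); the correction term in v completes
    it to minus a multiple of the square of r.  Dropping r gives joint convexity
    ([envelope_cvx_below]), while choosing x1 and x2 with r = 0 gives equality
    ([majorants_mix]). *)
Lemma bowl_mix t x1 x2 y1 y2 v1 v2 :
  let y := t *: y1 + (1 - t) *: y2 in
  let v := t * v1 + (1 - t) * v2
    - L * mu / (2 * (L - mu)) * (t * (1 - t)) * dot (y1 - y2) (y1 - y2) in
  let x := t *: x1 + (1 - t) *: x2 in
  let r := (L - mu) *: (x1 - x2) - L *: (y1 - y2) in
  bowl L (y, v) x - mu / 2 * dot x x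
    = t * (bowl L (y1, v1) x1 - mu / 2 * dot x1 x1)
      + (1 - t) * (bowl L (y2, v2) x2 - mu / 2 * dot x2 x2)
      - t * (1 - t) / (2 * (L - mu)) * dot r r.
Proof.
move=> y v x r; rewrite /bowl /y /v /x /r /= !dotE.
rewrite (dotC x2 x1) (dotC y1 x1) (dotC y2 x1) (dotC y1 x2) (dotC y2 x2).
rewrite (dotC y2 y1).
have Lmu0 : L - mu != 0 by rewrite subr_eq0 gt_eqF.
by field.
Qed.

(** A point x is split into x1 and x2 so that the remainder r of [bowl_mix]
    vanishes; the majorizations at x1 and x2 then add up to the one at x. *)
Lemma majorants_mix t y1 y2 v1 v2 : 0 <= t <= 1 ->
  majorants L M (y1, v1) -> majorants L M (y2, v2) ->
  majorants L M (t *: y1 + (1 - t) *: y2, t * v1 + (1 - t) * v2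
    - L * mu / (2 * (L - mu)) * (t * (1 - t)) * dot (y1 - y2) (y1 - y2)).
Proof.
move=> /[dup] t01 /andP[t0 t1] h1 h2 m Mm x.
have s0 : 0 <= 1 - t by rewrite subr_ge0.
pose w := (L / (L - mu)) *: (y1 - y2).
pose x1 := x + (1 - t) *: w; pose x2 := x - t *: w.
have xE : x = t *: x1 + (1 - t) *: x2.
  by apply/rowP => i; rewrite !mxE; ring.
have r0 : (L - mu) *: (x1 - x2) - L *: (y1 - y2) = 0.
  by apply/rowP => i; rewrite !mxE; field; rewrite subr_eq0 gt_eqF.
rewrite -(lerD2r (- (mu / 2 * dot x x))).
have := bowl_mix t x1 x2 y1 y2 v1 v2; rewrite /= -xE r0 dot0l mulr0 subr0 => E.
have := Mcvx Mm x1 x2 t01; rewrite -xE => C.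
have k1 := ler_wpM2l t0 (h1 _ Mm x1).
have k2 := ler_wpM2l s0 (h2 _ Mm x2).
lra.
Qed.

(** Nearly optimal majorants at x and y are mixed, and the mixture bounds the
    envelope at the convex combination. *)
Lemma envelope_cvx_below : cvx (fun x => envelope L M x - mu / 2 * dot x x).
Proof.
move=> t x y /[dup] t01 /andP[t0 t1].
have s0 : 0 <= 1 - t by rewrite subr_ge0.
apply/ler_addgt0Pr => e e0.
have [_ [[y1 v1] h1 <-] k1] := inf_adherent e0 (conj (values_n0 x) (values_lb x)).
have [_ [[y2 v2] h2 <-] k2] := inf_adherent e0 (conj (values_n0 y) (values_lb y)).
have hm := envelope_le (t *: x + (1 - t) *: y) (majorants_mix t01 h1 h2).
have := bowl_mix t x y y1 y2 v1 v2; rewrite /= => E.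
have r0 : 0 <= t * (1 - t) / (2 * (L - mu)) *
    dot ((L - mu) *: (x - y) - L *: (y1 - y2))
        ((L - mu) *: (x - y) - L *: (y1 - y2)).
  apply: mulr_ge0 (dot_ge0 _); apply: divr_ge0; apply: mulr_ge0 => //.
  by rewrite subr_ge0 ltW.
have := ler_wpM2l t0 (ltW k1); have := ler_wpM2l s0 (ltW k2).
rewrite -/(envelope L M x) -/(envelope L M y); lra.
Qed.

Lemma envelope_curvature : curvature_class mu L (envelope L M).
Proof.
split; apply: cvx_convex => t x y t01; rewrite !enorm_sqr.
  exact: envelope_cvx_above.
exact: envelope_cvx_below.
Qed.

End Envelope.

(** * The zigzag *)

Lemma odd_dist (R : realType) (i j : nat) : odd i != odd j ->
  1 <= (i%:R - j%:R : R) ^+ 2.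
Proof.
have H k l : (k < l)%N -> 1 <= (k%:R - l%:R : R) ^+ 2.
  move=> kl; have : (k%:R + 1 : R) <= l%:R by rewrite natr1 ler_nat.
  move=> ?; nra.
case: (ltngtP i j) => [/H //|/H|->]; last by rewrite eqxx.
by rewrite -sqrrN opprB.
Qed.

(** The gap between an upper tangent of the zigzag and a lower tangent an odd
    number n of steps away, in coordinates Y along and X across the direction of the
    zigzag.  Multiplied by 2 (L - mu), it is a sum of two squares (the completed
    squares in X and Y) and of (a b)^2 (n^2 - 1). *)
Lemma gap_ge0 (R : realType) (L mu gamma a b X Y n : R) :
  0 < L -> mu < 0 ->
  a ^+ 2 = (2 - gamma * mu) * (2 - gamma * L) ->
  b ^+ 2 = - (L * mu) * gamma ^+ 2 ->
  1 <= n ^+ 2 ->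
  0 <= 2 * b * X + gamma * b ^+ 2
       + L / 2 * (X ^+ 2 + Y ^+ 2)
       - mu / 2 * ((X + gamma * b) ^+ 2 + (Y + n * gamma * a) ^+ 2).
Proof.
move=> L0 mu0 ha hb hn.
have Lmu : 0 < 2 * (L - mu) by lra.
rewrite -(pmulr_rge0 _ Lmu).
have -> : 2 * (L - mu) * (2 * b * X + gamma * b ^+ 2
       + L / 2 * (X ^+ 2 + Y ^+ 2)
       - mu / 2 * ((X + gamma * b) ^+ 2 + (Y + n * gamma * a) ^+ 2))
  = ((L - mu) * X + (2 - gamma * mu) * b) ^+ 2
    + ((L - mu) * Y - mu * (n * gamma * a)) ^+ 2
    + (a ^+ 2 * n ^+ 2 * (- (L * mu) * gamma ^+ 2)
       - b ^+ 2 * ((2 - gamma * mu) * (2 - gamma * L))) by field.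
rewrite -ha -hb.
have -> : a ^+ 2 * n ^+ 2 * b ^+ 2 - b ^+ 2 * a ^+ 2
  = (a * b) ^+ 2 * (n ^+ 2 - 1) by ring.
rewrite addr_ge0 // ?addr_ge0 ?sqr_ge0 // mulr_ge0 ?sqr_ge0 //; lra.
Qed.

Section Quadratic.
Context {R : realType} {d : nat}.
Implicit Types p g x : 'rV[R]_d.

Definition quadratic (c f0 : R) g p x : R :=
  f0 + dot g (x - p) + c / 2 * dot (x - p) (x - p).

Lemma quadratic_base c f0 g p : quadratic c f0 g p p = f0.
Proof.
by rewrite /quadratic subrr !dot0r mulr0 !addr0.
Qed.

Lemma quadratic_bowl L f0 g p x : L != 0 ->
  quadratic L f0 g p x = bowl L (p - L^-1 *: g, f0 - dot g g / (2 * L)) x.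
Proof.
move=> L0; rewrite /quadratic /bowl /= !dotE.
by rewrite (dotC x p) (dotC x g) (dotC p g); field.
Qed.

Lemma cvx_quadratic c f0 g p :
  cvx (fun x => quadratic c f0 g p x - c / 2 * dot x x).
Proof.
move=> t x y _; rewrite /quadratic !dotE (dotC p x) (dotC p y) (dotC y x).
by rewrite le_eqVlt; apply/orP; left; apply/eqP; ring.
Qed.

End Quadratic.

Lemma cvx_cst (R : realType) (d : nat) (c mu : R) : mu <= 0 ->
  cvx (fun x : 'rV[R]_d => c - mu / 2 * dot x x).
Proof.
move=> mu0 t x y /andP[t0 t1].
have h : 0 <= - mu * (t * (1 - t) * dot (x - y) (x - y)).
  by rewrite !mulr_ge0 ?dot_ge0 ?oppr_ge0 ?subr_ge0.
by move: h; rewrite !dotE (dotC y x); lra.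
Qed.

Section Zigzag.
Context {R : realType} {d : nat}.
Variables (i0 i1 : 'I_d) (L mu gamma a b : R) (N : nat).
Hypothesis i01 : i0 != i1.
Hypothesis L0 : 0 < L.
Hypothesis mu0 : mu < 0.
Hypothesis g0 : 0 < gamma.
Hypothesis ha : a ^+ 2 = (2 - gamma * mu) * (2 - gamma * L).
Hypothesis hb : b ^+ 2 = - (L * mu) * gamma ^+ 2.

Let vec (p q : R) : 'rV[R]_d := p *: delta_mx 0 i0 + q *: delta_mx 0 i1.

Let vec0 p q : vec p q 0 i0 = p.
Proof. by rewrite !mxE !eqxx (negbTE i01) mulr1 mulr0 addr0. Qed.

Let vec1 p q : vec p q 0 i1 = q.
Proof. by rewrite !mxE !eqxx eq_sym (negbTE i01) mulr1 mulr0 add0r. Qed.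

Let dot_vec p q x : dot (vec p q) x = p * x 0 i0 + q * x 0 i1.
Proof. by rewrite !dotE !(dotC _ x) !dot_delta. Qed.

Definition zigzag i : 'rV[R]_d :=
  vec (- (i%:R * gamma * a)) (if odd i then - (gamma * b) else 0).
Definition zigzag_grad i : 'rV[R]_d := vec a (if odd i then - b else b).
Definition zigzag_val i : R := - (i%:R * gamma * a ^+ 2).

Lemma zigzag_step i : zigzag i.+1 = zigzag i - gamma *: zigzag_grad i.
Proof.
apply/rowP => k; rewrite /zigzag /zigzag_grad /vec !mxE /= -natr1.
by case: (odd i) => /=; ring.
Qed.

Lemma zigzag_grad_sqr i : dot (zigzag_grad i) (zigzag_grad i)
  = 2 * (2 - gamma * L - gamma * mu).
Proof.
rewrite dot_vec vec0 vec1 -!expr2.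
have -> : (if odd i then - b else b) ^+ 2 = b ^+ 2.
  by case: odd; rewrite ?sqrrN.
by rewrite ha hb; ring.
Qed.

Definition tangent c i := quadratic c (zigzag_val i) (zigzag_grad i) (zigzag i).

(** Only the two coordinates of the zigzag's plane matter, by [dot_ge_coord2].
    For equal parities the affine parts cancel; otherwise [gap_ge0] applies,
    after a reflection across the zigzag's axis if i is odd. *)
Lemma tangent_le i j x : tangent mu j x <= tangent L i x.
Proof.
have hi := dot_ge_coord2 (x - zigzag i) i01.
have hj := dot_ge_coord2 (x - zigzag j) i01.
rewrite /tangent /quadratic.
have L2 : 0 <= L / 2 by rewrite divr_ge0 // ltW.
have mu2 : 0 <= - mu / 2 by rewrite divr_ge0 // oppr_ge0 ltW.
have {}hi := ler_wpM2l L2 hi; have {}hj := ler_wpM2l mu2 hj.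
move: hi hj; rewrite /zigzag_grad !dot_vec.
have co (u v : 'rV[R]_d) k : (u - v) 0 k = u 0 k - v 0 k by rewrite !mxE.
rewrite !co !vec0 !vec1.
have [oij|oij] := boolP (odd i == odd j).
  rewrite -(eqP oij) /zigzag_val.
  set q := if _ then - b else b; set y := (if _ then _ else 0).
  set A := dot _ _; set B := dot _ _ => hi hj.
  have k1 : 0 <= L / 2 * ((x 0 i0 - - (i%:R * gamma * a)) ^+ 2
     + (x 0 i1 - y) ^+ 2) by rewrite mulr_ge0 ?addr_ge0 ?sqr_ge0.
  have k2 : 0 <= - mu / 2 * ((x 0 i0 - - (j%:R * gamma * a)) ^+ 2
     + (x 0 i1 - y) ^+ 2) by rewrite mulr_ge0 ?addr_ge0 ?sqr_ge0.
  lra.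
set A := dot _ _; set B := dot _ _ => hi hj; rewrite /zigzag_val.
rewrite eq_sym in oij.
move: hi hj (odd_dist R oij) => + + hn.
(* X is 0 on the side of the zigzag where point i lies, and - gamma b on the
   side of point j. *)
have := gap_ge0 (if odd i then - (x 0 i1 + gamma * b) else x 0 i1)
  (x 0 i0 + i%:R * gamma * a) L0 mu0 ha hb hn.
case: (odd i) oij; case: (odd j) => //= _ G hi hj; lra.
Qed.

(** The constant is the minimum of the upper tangent at index N; it makes the
    envelope attain its infimum. *)
Definition minorants : set ('rV[R]_d -> R) :=
  [set m | (exists2 i, (i <= N)%N & m = tangent mu i) \/
           m = cst (zigzag_val N - (2 - gamma * L - gamma * mu) / L)].

Definition zigzag_fun := envelope L minorants.

Let Ln0 : L != 0. Proof. by rewrite gt_eqF. Qed.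

(** The pair is the vertex of the upper tangent at index i.  It is above the
    constant of [minorants] because the values decrease along the zigzag. *)
Lemma tangent_majorant i : (i <= N)%N ->
  majorants L minorants (zigzag i - L^-1 *: zigzag_grad i,
    zigzag_val i - (2 - gamma * L - gamma * mu) / L).
Proof.
move=> iN m Mm x.
set D := 2 - _ - _.
have E : D / L = dot (zigzag_grad i) (zigzag_grad i) / (2 * L).
  by rewrite zigzag_grad_sqr -/D; field.
case: Mm => [[j _ ->]|->].
  by rewrite E -quadratic_bowl //; exact: tangent_le.
rewrite /bowl /= -/D.
have : zigzag_val N <= zigzag_val i.
  rewrite /zigzag_val lerN2 -!mulrA ler_wpM2r ?ler_nat //.
  by rewrite mulr_ge0 ?sqr_ge0 // ltW.
have : 0 <= L / 2 * dot (x - (zigzag i - L^-1 *: zigzag_grad i))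
    (x - (zigzag i - L^-1 *: zigzag_grad i)).
  by rewrite mulr_ge0 ?dot_ge0 ?divr_ge0 // ltW.
lra.
Qed.

Let minorants0 : minorants !=set0.
Proof. by eexists; right; reflexivity. Qed.

Let majorants0 : majorants L minorants !=set0.
Proof. by eexists; exact: (@tangent_majorant 0). Qed.

Lemma zigzag_curvature : curvature_class mu L zigzag_fun.
Proof.
apply: envelope_curvature => //; first exact: lt_trans mu0 L0.
move=> m [[i _ ->]|->]; first exact: cvx_quadratic.
by apply: cvx_cst; exact: ltW.
Qed.

Lemma zigzag_fun_le i x : (i <= N)%N -> zigzag_fun x <= tangent L i x.
Proof.
move=> iN; rewrite /tangent quadratic_bowl // zigzag_grad_sqr.
have -> : 2 * (2 - gamma * L - gamma * mu) / (2 * L)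
  = (2 - gamma * L - gamma * mu) / L by field.
by apply: envelope_le => //; exact: tangent_majorant.
Qed.

Lemma zigzag_fun_ge i x : (i <= N)%N -> tangent mu i x <= zigzag_fun x.
Proof. by move=> iN; apply: envelope_ge => //; left; exists i. Qed.

Lemma zigzag_funE i : (i <= N)%N -> zigzag_fun (zigzag i) = zigzag_val i.
Proof.
move=> iN; apply/eqP; rewrite eq_le.
rewrite (le_trans (zigzag_fun_le _ iN)) ?(le_trans _ (zigzag_fun_ge _ iN)) //.
  by rewrite /tangent quadratic_base.
by rewrite /tangent quadratic_base.
Qed.

Lemma grad_zigzag i : (i <= N)%N -> grad zigzag_fun (zigzag i) = zigzag_grad i.
Proof.
move=> iN; apply: (@grad_sandwich _ _ mu L) => x; rewrite zigzag_funE //.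
  exact: zigzag_fun_ge.
exact: zigzag_fun_le.
Qed.

Lemma gd_zigzag i : (i <= N)%N -> gd gamma zigzag_fun (zigzag 0) i = zigzag i.
Proof.
elim: i => [//|i IH] iN.
rewrite /gd iterS -/(gd _ _ _ _) IH ?(ltnW iN) //.
by rewrite grad_zigzag ?zigzag_step // ltnW.
Qed.

Lemma min_sq_grad_zigzag : min_sq_grad gamma zigzag_fun (zigzag 0) N
  = 2 * (2 - gamma * L - gamma * mu).
Proof.
have H i : (i <= N)%N ->
    enorm (grad zigzag_fun (gd gamma zigzag_fun (zigzag 0) i)) ^+ 2
    = 2 * (2 - gamma * L - gamma * mu).
  by move=> iN; rewrite gd_zigzag // grad_zigzag // enorm_sqr zigzag_grad_sqr.
apply: (big_ind (fun r => r = 2 * (2 - gamma * L - gamma * mu))).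
- exact: (H 0%N).
- by move=> _ _ -> ->; rewrite minxx.
- by move=> i _; apply: H; rewrite -ltnS.
Qed.

Lemma zigzag_fun_lb x :
  zigzag_val N - (2 - gamma * L - gamma * mu) / L <= zigzag_fun x.
Proof.
exact: (@envelope_ge _ _ _ _ majorants0 (cst _) x (or_intror erefl)).
Qed.

(** The bound is attained at the minimizer of the last upper tangent. *)
Lemma inf_zigzag_fun : inf (range zigzag_fun)
  = zigzag_val N - (2 - gamma * L - gamma * mu) / L.
Proof.
have lb : lbound (range zigzag_fun)
    (zigzag_val N - (2 - gamma * L - gamma * mu) / L).
  by move=> _ [x _ <-]; exact: zigzag_fun_lb.
apply/eqP; rewrite eq_le; apply/andP; split; last first.
  by apply: lb_le_inf => //; exists (zigzag_fun 0), 0.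
pose x := zigzag N - L^-1 *: zigzag_grad N.
apply: (le_trans (y := zigzag_fun x)).
  by apply: ge_inf; [eexists; exact: lb | exists x].
have := envelope_le minorants0 x (tangent_majorant (leqnn N)).
by rewrite /bowl /= subrr dot0l mulr0 addr0.
Qed.

End Zigzag.


(** * The theorem *)

Lemma gammaL1_lt2 (R : realType) (kappa : R) : kappa < 0 -> gammaL1 kappa < 2.
Proof.
move=> k0; rewrite /gammaL1.
have s : 1 / 2 - kappa < Num.sqrt (1 - kappa + kappa ^+ 2).
  (* The square of the left-hand side is 1/4 - kappa + kappa^2. *)
  have h0 : 0 <= 1 / 2 - kappa by lra.
  rewrite -(ger0_norm h0) -sqrtr_sqr ltr_sqrt; nra.
rewrite ltr_pdivrMr; lra.
Qed.

(* The last conjunct excludes the degenerate witnesses (f constant, 0 = 0). It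
   is stated for d > 1 because the known extremal iterates zigzag in a plane. *)
Theorem proposition5p10 (R : realType) (d N : nat) (L mu gamma : R)
    (hd : (0 < d)%N) (hN : (0 < N)%N) (hL : 0 < L) (hmu : mu < 0)
    (hgamma1 : 1 < gamma * L) (hgamma2 : gamma * L <= gammaL1 (mu / L)) :
  exists (x0 : 'rV[R]_d) (f : 'rV[R]_d -> R),
    [/\ curvature_class mu L f,
        has_lbound (range f),
        1 / (2 * L) * min_sq_grad gamma f x0 N =
          (f x0 - inf (range f)) /
          (1 + gamma * L * ((2 - gamma * L) * (2 - gamma * mu) /
                            (2 - gamma * L - gamma * mu)) * N%:R)
      & (1 < d)%N -> inf (range f) < f x0].
Proof.
have gL2 : gamma * L < 2.
  by apply: le_lt_trans hgamma2 _; rewrite gammaL1_lt2 // ltr_pdivrMr // mul0r.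
have g0 : 0 < gamma by rewrite -(pmulr_lgt0 _ hL); lra.
have gmu : gamma * mu < 0 by rewrite pmulr_rlt0.
have [d1|d1] := leqP d 1.
  (* On the line: a constant function. *)
  exists 0, (cst 0); split; last by [].
  - split; apply: cvx_convex => t x y t01; rewrite !enorm_sqr.
      have := @cvx_cst R d 0 (- L); rewrite oppr_le0 => /(_ (ltW hL) t x y t01).
      lra.
    by have := @cvx_cst R d 0 mu (ltW hmu) t x y t01.
  - by exists 0 => _ [x _ <-].
  - have gr x : grad (cst 0 : 'rV[R]_d -> R) x = 0.
      by apply: (@grad_sandwich _ _ 0 0) => y /=; rewrite dot0l !mul0r !addr0.
    have gr0 x : enorm (grad (cst 0 : 'rV[R]_d -> R) x) ^+ 2 = 0.
      by rewrite gr enorm_sqr dot0l.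
    have -> : range (cst 0 : 'rV[R]_d -> R) = [set 0].
      by apply/seteqP; split => [_ [x _ <-]|_ ->] //=; exists 0.
    rewrite inf1 subrr mul0r /min_sq_grad gr0.
    rewrite (big_ind (fun r => r = 0)) ?mulr0 //.
    by move=> _ _ -> ->; rewrite minxx.
pose a := Num.sqrt ((2 - gamma * mu) * (2 - gamma * L)).
pose b := Num.sqrt (- (L * mu) * gamma ^+ 2).
have ha : a ^+ 2 = (2 - gamma * mu) * (2 - gamma * L).
  by rewrite sqr_sqrtr // mulr_ge0 //; lra.
have hb : b ^+ 2 = - (L * mu) * gamma ^+ 2.
  by rewrite sqr_sqrtr // mulr_ge0 ?sqr_ge0 // oppr_ge0 pmulr_rle0 // ltW.
pose i0 := Ordinal (ltnW d1); pose i1 := Ordinal d1.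
have i01 : i0 != i1 by [].
exists (zigzag i0 i1 gamma a b 0), (zigzag_fun i0 i1 L mu gamma a b N).
have D0 : 0 < 2 - gamma * L - gamma * mu by lra.
have f0 : zigzag_fun i0 i1 L mu gamma a b N (zigzag i0 i1 gamma a b 0) = 0.
  by rewrite zigzag_funE // /zigzag_val !mul0r oppr0.
split.
- exact: zigzag_curvature.
- by eexists => _ [x _ <-]; exact: zigzag_fun_lb.
- rewrite min_sq_grad_zigzag // inf_zigzag_fun // f0 /zigzag_val ha.
  rewrite !sub0r.
  have Q0 : 0 <= gamma * L * ((2 - gamma * L) * (2 - gamma * mu)) * N%:R.
    by rewrite !mulr_ge0 //; lra.
  field; rewrite !gt_eqF //; lra.
- move=> _; rewrite inf_zigzag_fun // f0 /zigzag_val.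
  have : 0 < (2 - gamma * L - gamma * mu) / L by rewrite divr_gt0.
  have : 0 <= N%:R * gamma * a ^+ 2.
    by rewrite mulr_ge0 ?sqr_ge0 // mulr_ge0 // ltW.
  lra.
Qed.
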